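(* Let $r \geq 2$ be an integer, $m = r^{\binom{r+1}{2}} - r^{\binom{r}{2}} + 1$ and $n = r^{r-1}(r^r - 1) + r + 1$. Then $g(m,n) \geq r+1$.
   Context: For positive integers $m,n$, the grid graph $\Gamma_{m,n} = K_m \times K_n$ has vertex set $[m]\times[n]$ (where $[k]=\{1,\dots,k\}$), and two distinct vertices $(i,j)$, $(i',j')$ are adjacent if and only if $i=i'$ or $j=j'$. A rectangle is a set of four vertices $\{(i,j),(i',j),(i,j'),(i',j')\}$ with $1\le i<i'\le m$ and $1\le j<j'\le n$. Given a colouring of $E(\Gamma_{m,n})$, a rectangle is called alternating if its parallel edges receive the same colour, that is, the edges $\{(i,j),(i',j)\}$ and $\{(i,j'),(i',j')\}$ have the same colour, and the edges $\{(i,j),(i,j')\}$ and $\{(i',j),(i',j')\}$ have the same colour. An $r$-colouring is an arbitrary (not necessarily proper) assignment of colours from a set of $r$ colours. For positive integers $m,n$, $g(m,n)$ is the smallest number $r$ such that there exists an $r$-colouring of $E(\Gamma_{m,n})$ without alternating rectangles. *)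

(* Defs.v *)
From mathcomp Require Import all_boot.
Set Implicit Arguments.
Unset Strict Implicit.
Unset Printing Implicit Defensive.

Section GridGraph.
Variables m n : nat.

Definition grid_adj : rel ('I_m * 'I_n) :=
  fun u v => (u != v) && ((u.1 == v.1) || (u.2 == v.2)).

Definition grid_edges : {set {set 'I_m * 'I_n}} :=
  [set e : {set 'I_m * 'I_n} |
    [exists u, exists v, grid_adj u v && (e == [set u; v])]].

Definition grid_edge : finType := {e | e \in grid_edges}.

Definition grid_colouring (r : nat) : finType := {ffun grid_edge -> 'I_r}.

(* [Some] of the colour of the edge {u, v}; [None] if u, v are not adjacent.
   Only ever used below on adjacent pairs (see [edge_colourE]). *)
Definition edge_colour r (c : grid_colouring r) (u v : 'I_m * 'I_n) :
  option 'I_r := omap c (insub [set u; v]).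

(* The rectangle with corners (i,j), (i',j), (i,j'), (i',j'), for i < i' and
   j < j'. *)
Definition alternating r (c : grid_colouring r) (i i' : 'I_m) (j j' : 'I_n) :
  bool :=
  (edge_colour c (i, j) (i', j) == edge_colour c (i, j') (i', j')) &&
  (edge_colour c (i, j) (i, j') == edge_colour c (i', j) (i', j')).

Definition has_alternating_rectangle r (c : grid_colouring r) : bool :=
  [exists i : 'I_m, exists i' : 'I_m, exists j : 'I_n, exists j' : 'I_n,
    [&& i < i', j < j' & alternating c i i' j j']].

Definition good_colours (r : nat) : bool :=
  [exists c : grid_colouring r, ~~ has_alternating_rectangle c].

Lemma mem_grid_edges u v : grid_adj u v -> [set u; v] \in grid_edges.
Proof.
by move=> uv; rewrite inE; apply/existsP; exists u; apply/existsP; exists v;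
  rewrite uv eqxx.
Qed.

Lemma edge_colourE r (c : grid_colouring r) u v (uv : grid_adj u v) :
  edge_colour c u v =
  Some (c (exist (fun e => e \in grid_edges) [set u; v] (mem_grid_edges uv))).
Proof.
by rewrite /edge_colour (insubT (fun e => e \in grid_edges) (mem_grid_edges uv)).
Qed.

Lemma good_colours_exist : exists r, good_colours r.
Proof.
exists #|grid_edge|; apply/existsP; exists [ffun e => enum_rank e].
apply/existsPn => i; apply/existsPn => i'; apply/existsPn => j.
apply/existsPn => j'; apply/negP => /and3P[lti ltj /andP[+ _]].
have ne : i != i' by rewrite -val_eqE /= neq_ltn lti.
have nej : j != j' by rewrite -val_eqE /= neq_ltn ltj.
have adj k : grid_adj (i, k) (i', k).
  by rewrite /grid_adj /= eqxx orbT andbT xpair_eqE (negbTE ne).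
rewrite !(edge_colourE _ (adj _)) => /eqP/Some_inj; rewrite !ffunE.
move=> /enum_rank_inj/(congr1 val)/= /setP/(_ (i, j)).
by rewrite !inE !xpair_eqE !eqxx (negbTE nej) !andbF.
Qed.

Definition g : nat := ex_minn good_colours_exist.

End GridGraph.

(* Main.v *)
Require Import Defs.
From mathcomp Require Import all_boot all_order all_algebra zify.

(** Write [r = q + 1] and suppose that [r] colours suffice.  Two rows that agree
    on all pairs of an [r + 1]-set of columns would give an alternating
    rectangle, by the pigeonhole principle on the edges joining the two rows.
    Fix a set [P] of [q] columns; some [N = r^q (r^r - 1) + 1] rows agree on
    [P].  A further column [w] splits these rows into [r^q] classes according to
    the colours of the edges from [w] to [P].  Each class has at most [r^r] rows, so
    the value of [N] forces a class [R_w] with exactly [r^r] rows; moreover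
    [R_w] and [R_w'] meet in exactly [r] rows.  Fisher's inequality then
    bounds the number [n - q = N + 1] of these classes by [N]. *)

Section Fisher.
Import Order.TTheory GRing.Theory Num.Theory.
Local Open Scope ring_scope.

(** The incidence matrix [M] satisfies M M^T = lam J + (k - lam) I, with J the all-ones matrix. This
    is nonsingular because lam < k, so the rows of [M] are linearly independent and cannot outnumber
    its columns. *)
Lemma fisher_inequality (I W : finType) (X : {set I}) (D : {set W})
    (R : W -> {set I}) (k lam : nat) :
  (lam < k)%N ->
  {in D, forall w, R w \subset X} ->
  {in D, forall w, #|R w| = k} ->
  {in D &, forall w w', w != w' -> #|R w :&: R w'| = lam} ->
  (#|D| <= #|X|)%N.
Proof.
move=> lt_lam_k RX Rk Rlam.
pose M : 'M[rat]_(#|D|, #|X|) :=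
  \matrix_(i, j) (enum_val j \in R (enum_val i))%:R.
have gram i i' : (M *m M^T) i i' = lam%:R + (k - lam)%:R * (i == i')%:R.
  have -> : (M *m M^T) i i' = #|R (enum_val i) :&: R (enum_val i')|%:R.
    set A := _ :&: _; rewrite mxE.
    under eq_bigr => j _ do rewrite !mxE -natrM mulnb -in_setI -/A.
    rewrite -natr_sum -(@big_enum_val _ _ _ _ (mem X)
      (fun x => nat_of_bool (x \in A))) /=.
    have -> : (\sum_(x in X) nat_of_bool (x \in A) =
        \sum_(x in X | x \in A) 1)%N.
      by rewrite big_mkcondr.
    rewrite sum1dep_card cardsE; congr _%:R; apply: eq_card => x.
    rewrite unfold_in andb_idl // => /setIP[xR _].
    by apply: (subsetP (RX _ (enum_valP i))).
  have [->|ne] := eqVneq i i'.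
    by rewrite setIid Rk ?enum_valP // mulr1 -natrD subnKC // ltnW.
  by rewrite Rlam ?enum_valP ?mulr0 ?addr0 // (inj_eq enum_val_inj).
suff freeM : row_free M by rewrite -(eqP freeM) rank_leq_col.
rewrite -kermx_eq0; apply/rowV0P => v /sub_kermxP vM0.
pose s := \sum_i v 0 i.
have vE i : lam%:R * s + (k - lam)%:R * v 0 i = 0.
  have: (v *m (M *m M^T)) 0 i = 0 by rewrite mulmxA vM0 mul0mx mxE.
  rewrite mxE; under eq_bigr => j _ do rewrite gram mulrDr.
  rewrite big_split /= -mulr_suml mulrC -/s => <-; congr (_ + _).
  rewrite (bigD1 i) //= eqxx mulr1 big1 ?addr0 1?mulrC // => j /negbTE->.
  by rewrite !mulr0.
have kl0 : (k - lam)%:R != 0 :> rat by rewrite pnatr_eq0 -lt0n subn_gt0.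
(* Summing [vE] over all i gives (lam |D| + (k - lam)) s = 0, where the factor of s is positive. *)
have s0 : s = 0.
  have: \sum_(i < #|D|) (lam%:R * s + (k - lam)%:R * v 0 i) = 0.
    by rewrite big1.
  rewrite big_split /= sumr_const card_ord -mulr_sumr -/s -mulrnAl -mulrDl.
  move/eqP; rewrite mulf_eq0 => /orP[|/eqP //].
  by rewrite -mulrnA -natrD pnatr_eq0 addn_eq0 subn_eq0 leqNgt lt_lam_k andbF.
apply/rowP => i; rewrite mxE; have /eqP := vE i.
by rewrite s0 mulr0 add0r mulf_eq0 (negbTE kl0) /= => /eqP.
Qed.

End Fisher.

Lemma pigeonhole_fiber (I L : finType) (X : {set I}) (e : I -> L) (b : nat) :
  #|L| * b < #|X| -> exists a, b < #|[set i in X | e i == a]|.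
Proof.
move=> ltX; apply/existsP; apply: contraLR ltX => /existsPn small.
rewrite -leqNgt -sum1_card (partition_big e predT) //= -sum_nat_const.
apply: leq_sum => a _; rewrite sum1dep_card leqNgt.
by have := small a; rewrite cardsE.
Qed.

Lemma subset_of_card (T : finType) (A : {set T}) (k : nat) :
  k <= #|A| -> exists2 B : {set T}, B \subset A & #|B| = k.
Proof.
move=> lek; have: 0 < #|[set B : {set T} | B \subset A & #|B| == k]|.
  by rewrite cards_draws bin_gt0.
by case/card_gt0P => B; rewrite inE => /andP[sBA /eqP]; exists B.
Qed.

(** For w <> w', each class of [l w] embeds in L x C through [l w'] and [f w w'], so it has at most
    |L||C| rows; the size of [X] forces one class to attain this. A full class maps bijectively onto
    L x C, hence meets every class of [l w'] in exactly |C| rows. Fisher's inequality is applied to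
    one full class per column. *)
Lemma separated_columns_bound (I W L C : finType) (X : {set I}) (D : {set W})
    (l : W -> I -> L) (f : W -> W -> I -> C) :
  1 < #|L| -> 0 < #|C| ->
  {in D &, forall w w', w != w' ->
     {in X &, injective (fun i => (l w i, (l w' i, f w w' i)))}} ->
  #|X| = #|L| * (#|L| * #|C| - 1) + 1 ->
  #|D| <= #|X|.
Proof.
move=> L1 C0 finj cardX.
have [D1|D1] := leqP #|D| 1; first by rewrite cardX addn1 (leq_trans D1).
have other w : w \in D -> exists2 w', w' \in D & w != w'.
  move=> wD; have: 0 < #|D :\ w| by rewrite (cardsD1 w) wD in D1.
  by case/card_gt0P => w'; rewrite !inE eq_sym => /andP[]; exists w'.
pose F w a := [set i in X | l w i == a].
have inj2 w w' a : w \in D -> w' \in D -> w != w' ->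
    {in F w a &, injective (fun i => (l w' i, f w w' i))}.
  move=> wD w'D ne i i'; rewrite !inE.
  move=> /andP[iX /eqP li] /andP[i'X /eqP li'] [e1 e2].
  by apply: (finj w w') => //=; rewrite li li' e1 e2.
have Fle w a : w \in D -> #|F w a| <= #|L| * #|C|.
  move=> wD; have [w' w'D ne] := other w wD.
  by rewrite -(card_in_imset (inj2 w w' a wD w'D ne)) -card_prod max_card.
have Ffull w : w \in D -> exists a, #|F w a| == #|L| * #|C|.
  move=> wD; have [|a lta] := @pigeonhole_fiber I L X (l w) (#|L| * #|C| - 1).
    by rewrite cardX addn1.
  exists a; rewrite eqn_leq Fle //=.
  by apply: leq_trans lta; rewrite subn1 leqSpred.
have L0 : L by apply: (@enum_val _ predT); exact: Ordinal (ltnW L1).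
(* The default [L0] is never taken on [D], by [Ffull]. *)
pose a w := odflt L0 [pick a | #|F w a| == #|L| * #|C|].
have aP w : w \in D -> #|F w (a w)| = #|L| * #|C|.
  move=> /Ffull[b Fb]; rewrite /a; case: pickP => [b' /eqP //|/(_ b)].
  by rewrite Fb.
apply: (@fisher_inequality I W X D (fun w => F w (a w)) (#|L| * #|C|) #|C|).
- by rewrite -[ltnLHS]mul1n ltn_pmul2r.
- by move=> w _; apply/subsetP => i; rewrite inE => /andP[].
- by [].
move=> w w' wD w'D ne; pose h i := (l w' i, f w w' i).
have hinj := inj2 w w' (a w) wD w'D ne.
have himg : h @: F w (a w) = setT.
  apply/eqP; rewrite eqEcard subsetT cardsT card_prod.
  by rewrite (card_in_imset hinj) aP /=.
rewrite -(@card_in_imset _ _ h); last first.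
  by move=> i i' /setIP[iF _] /setIP[i'F _]; exact: hinj.
(* Both sides are now counted inside L x C: [h] maps the intersection onto {a w'} x C. *)
rewrite -[RHS](card_imset _ (f := pair (a w'))); last by move=> c c' [].
apply: eq_card => -[b c]; apply/imsetP/imsetP => -[].
  move=> i; rewrite !inE => /andP[_ /andP[_ /eqP li]] [-> ->].
  by exists (f w w' i); rewrite ?li.
move=> c' _ [-> ->]; have: (a w', c') \in h @: F w (a w) by rewrite himg.
case/imsetP => i iF e; exists i => //; rewrite inE iF inE.
by case: e => -> _; move: iF; rewrite inE => /andP[-> _] /=.
Qed.

Lemma separated_rows_bound (I J C : finType) (f : I -> {set J} -> C) (q : nat) :
  0 < q -> #|C| = q.+1 ->
  (forall (i i' : I) (Q : {set J}), #|Q| = q.+2 ->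
     (forall A : {set J}, A \subset Q -> #|A| = 2 -> f i A = f i' A) ->
     i = i') ->
  q.+1 ^ q * (q.+1 ^ q.+1 - 1) + q.+2 <= #|J| ->
  #|I| <= q.+1 ^ 'C(q.+1, 2) * (q.+1 ^ q.+1 - 1).
Proof.
move=> q0 cardC sep leJ; rewrite leqNgt; apply/negP => ltI.
have [|P _ cardP] := @subset_of_card J setT q.
    by rewrite cardsT; apply: leq_trans (leq_trans (leq_addl _ _) leJ); lia.
pose E := [set A : {set J} | A \subset P & #|A| == 2].
pose e i := [ffun A : {A | A \in E} => f i (val A)].
have cardE : #|{ffun {A | A \in E} -> C}| = q.+1 ^ 'C(q, 2).
  by rewrite card_ffun card_sig cardsE -cardsE cards_draws cardP cardC.
set N := q.+1 ^ q * (q.+1 ^ q.+1 - 1) in leJ *.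
(* Since C(q+1, 2) = C(q, 2) + q, there are more than r^C(q, 2) N rows for the r^C(q, 2) colour
   patterns on [P], where r = q + 1. *)
have [|p ltp] := @pigeonhole_fiber I _ setT e N.
  by rewrite cardE cardsT /N mulnA -expnD -[q in _ + q]bin1 -binS.
have [X /subsetP sX cardX] := subset_of_card _ _ _ ltp.
have eX i i' (A : {set J}) : i \in X -> i' \in X -> A \subset P -> #|A| = 2 ->
    f i A = f i' A.
  move=> /sX + /sX; rewrite !inE /= => /eqP ei /eqP ei' sAP cA.
  have AE : A \in E by rewrite inE sAP cA.
  have := congr1 (fun g : {ffun _} => g (exist _ A AE)) (etrans ei (esym ei')).
  by rewrite !ffunE.
pose l w i := [ffun x : {x | x \in P} => f i [set val x; w]].
have cardL : #|{ffun {x | x \in P} -> C}| = q.+1 ^ q.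
  by rewrite card_ffun card_sig cardC cardP.
have := @separated_columns_bound I J _ C X (~: P) l
          (fun w w' i => f i [set w; w']).
rewrite cardL cardC -expnSr -/N cardX addn1 => /(_ _ isT _ erefl) bound.
have: #|~: P| <= N.+1.
  apply: bound; first by rewrite -[1](exp1n q) ltn_exp2r.
  move=> w w'; rewrite !inE => wP w'P ne i i' iX i'X [lw lw' fww'].
  (* A pair inside this set of q + 2 columns is {w, w'}, or joins w or w' to [P], or lies in [P];
     these cases are settled by [fww'], [fl] and [eX]. *)
  apply: (sep i i' (w |: (w' |: P))) => [|A sA cA].
    by rewrite !cardsU1 !inE negb_or ne wP w'P cardP.
  have fl v x : v \in [:: w; w'] -> x \in P -> f i [set x; v] = f i' [set x; v].
    move=> vw xP; have: l v i = l v i'.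
      by move: vw; rewrite !inE => /orP[]/eqP->.
    by move/ffunP/(_ (exist _ x xP)); rewrite !ffunE.
  have /cards2P[x [y [nexy defA]]] : #|A| == 2 by apply/eqP.
  move: sA; rewrite defA subUset !sub1set !inE.
  case/andP => /or3P[/eqP xw|/eqP xw|xP] /or3P[/eqP yw|/eqP yw|yP]; subst => //.
  all: try by [rewrite eqxx in nexy | rewrite setUC
    | apply: fl; rewrite ?inE ?eqxx ?orbT
    | rewrite setUC; apply: fl; rewrite ?inE ?eqxx ?orbT].
  by apply: eX => //; rewrite subUset !sub1set xP yP.
(* At least N + 2 columns lie outside [P], one too many. *)
have := cardsC P; rewrite cardP; lia.
Qed.

(** Two of the r + 2 edges joining rows [i] and [i'] in the columns of [Q] share one of r + 1
    colours; agreement of the two rows on that pair of columns would complete an alternating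
    rectangle. *)
Lemma good_colours_separated (m n s r : nat) (c : grid_colouring m n s) :
  ~~ has_alternating_rectangle c -> s <= r.+1 ->
  exists f : 'I_m -> {set 'I_n} -> 'I_r.+1,
    forall (i i' : 'I_m) (Q : {set 'I_n}), #|Q| = r.+2 ->
     (forall A : {set 'I_n}, A \subset Q -> #|A| = 2 -> f i A = f i' A) ->
     i = i'.
Proof.
move=> noalt les.
(* The value [ord0] off the edges is harmless: [col] is compared only on edges, where [colP]
   recovers the original colours. *)
pose col (e : {set 'I_m * 'I_n}) : 'I_r.+1 :=
  odflt ord0 (omap (widen_ord les) (omap c (insub e))).
have colP u v u' v' : grid_adj u v -> grid_adj u' v' ->
    col [set u; v] = col [set u'; v'] ->
    edge_colour c u v = edge_colour c u' v'.
  move=> uv uv'; rewrite /col -!/(edge_colour c _ _).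
  rewrite (edge_colourE c uv) (edge_colourE c uv') /=.
  by move=> /(congr1 val)/= /val_inj ->.
exists (fun i (A : {set 'I_n}) => col [set (i, j) | j in A]).
move=> i i' Q cQ; wlog lti : i i' / i < i' => [hw agr|agr].
  have [lt|lt|/val_inj //] := ltngtP i i'; first exact: hw.
  by apply/esym/hw => // A sA cA; apply/esym/agr.
have nei : i != i' by rewrite -val_eqE /= neq_ltn lti.
pose d j := col [set (i, j); (i', j)].
have: ~~ [forall j in Q, forall j' in Q, (d j == d j') ==> (j == j')].
  apply/negP => /'forall_in_'forall_in_implyP dinj.
  suff: #|Q| <= r.+1 by rewrite cQ ltnn.
  rewrite -(@card_in_imset _ _ d) => [|j j' jQ j'Q /eqP].
    by rewrite -[leqRHS]card_ord max_card.
  by move=> /(dinj j jQ j' j'Q)/eqP.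
case/forall_inPn => j jQ /forall_inPn[j' j'Q]; rewrite negb_imply => /andP[].
wlog ltj : j j' jQ j'Q / j < j' => [hw|].
  move=> djj' nej; have [lt|lt|/val_inj e] := ltngtP j j'.
  - exact: (hw j j').
  - by apply: (hw j' j) => //; rewrite eq_sym.
  - by rewrite e eqxx in nej.
move=> /eqP djj' nej; case/negP: noalt.
apply/existsP; exists i; apply/existsP; exists i'.
apply/existsP; exists j; apply/existsP; exists j'.
rewrite lti ltj /=; apply/andP; split; apply/eqP/colP => //;
  rewrite /grid_adj /= ?xpair_eqE ?eqxx ?orbT ?andbT ?andTb //=.
have := agr [set j; j']; rewrite !imsetU1 !imset_set1; apply.
  by rewrite subUset !sub1set jQ.
by rewrite cards2 nej.
Qed.

Theorem theorem1p4 (r m n : nat) (hr : 2 <= r)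
  (hm : m = r ^ 'C(r + 1, 2) - r ^ 'C(r, 2) + 1)
  (hn : n = r ^ (r - 1) * (r ^ r - 1) + r + 1) :
  r + 1 <= g m n.
Proof.
case: r hr hm hn => [//|q] q0 hm hn; rewrite addn1 ltnNge; apply/negP => leg.
have : good_colours m n (g m n) by rewrite /g; case: ex_minnP.
case/existsP => c /good_colours_separated/(_ leg)[f sep].
have := @separated_rows_bound _ _ _ f q q0 (card_ord _) sep.
rewrite !card_ord hn [q.+1 - 1]subn1 -addnA addn1 => /(_ (leqnn _)).
(* With r = q + 1, r^C(r+1, 2) - r^C(r, 2) = r^C(r, 2) (r^r - 1), so m exceeds the bound by one. *)
by rewrite hm !addn1 binS bin1 expnD mulnBr muln1 ltnn.
Qed.
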